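(* Let $G$ be an abelian (locally compact) group, $(X,G)$ a minimal continuous action and $m\in\mathbb{N}$, $m\geq 2$. Then $(X,G)$ is $m$-equicontinuous if and only if $r_M(X,G)\leq m-1$.
   Context: $G$ acts continuously on a compact metric space $(X,d)$; minimal means every orbit is dense. $(X,G)$ is $m$-equicontinuous if for every $x\in X$ and $\varepsilon>0$ there is $\delta>0$ such that for any $x_1,\dots,x_m$ in the open ball $B_\delta(x)$ and every $g\in G$ there exist $i\neq j$ with $d(gx_i,gx_j)<\varepsilon$. The maximal equicontinuous factor $\pi_{eq}\colon X\to X_{eq}$ is the factor map onto the equicontinuous factor of $(X,G)$ of which every equicontinuous factor is a factor. The maximal rank is $r_M(X,G)=\sup\{|\pi_{eq}^{-1}(y)|: y\in X_{eq}\}$. *)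

(* Defs.v *)
From HB Require Import structures.
From mathcomp Require Import all_boot all_order all_algebra.
From mathcomp Require Import all_classical all_reals all_analysis.
Set Implicit Arguments. Unset Strict Implicit. Unset Printing Implicit Defensive.
Import Order.TTheory GRing.Theory Num.Theory.
Local Open Scope classical_set_scope.
Local Open Scope ring_scope.

Definition is_action (G : zmodType) (X : Type) (act : G -> X -> X) : Prop :=
  (forall x, act 0 x = x) /\ (forall g h x, act (g + h) x = act g (act h x)).

Definition continuous_action (G : topologicalZmodType) (X : topologicalType)
    (act : G -> X -> X) : Prop :=
  is_action act /\ continuous (fun p : G * X => act p.1 p.2).

Definition minimal_action (G : zmodType) (X : topologicalType)
    (act : G -> X -> X) : Prop :=
  forall x : X, closure (range (fun g => act g x)) = [set: X].

Definition equicontinuous_action (R : realType) (G : zmodType) (Y : metricType R)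
    (act : G -> Y -> Y) : Prop :=
  forall (y : Y) (e : R), 0 < e -> exists2 d : R, 0 < d &
    forall y' : Y, mdist y y' < d -> forall g : G, mdist (act g y) (act g y') < e.

Definition m_equicontinuous (R : realType) (G : zmodType) (X : metricType R)
    (m : nat) (act : G -> X -> X) : Prop :=
  forall (x : X) (e : R), 0 < e -> exists2 d : R, 0 < d &
    forall xs : 'I_m -> X, (forall i, mdist x (xs i) < d) ->
      forall g : G, exists i j : 'I_m, i != j /\ mdist (act g (xs i)) (act g (xs j)) < e.

Definition factor_map (G : zmodType) (X Y : topologicalType)
    (actX : G -> X -> X) (actY : G -> Y -> Y) (pi : X -> Y) : Prop :=
  [/\ continuous pi, (forall y, exists x, pi x = y) &
      forall g x, pi (actX g x) = actY g (pi x)].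

Definition max_equicontinuous_factor (R : realType) (G : topologicalZmodType)
    (X : metricType R) (actX : G -> X -> X)
    (Y : metricType R) (actY : G -> Y -> Y) (pi : X -> Y) : Prop :=
  [/\ continuous_action actY, factor_map actX actY pi,
      equicontinuous_action actY &
      forall (Z : metricType R) (actZ : G -> Z -> Z) (psi : X -> Z),
        continuous_action actZ -> factor_map actX actZ psi ->
        equicontinuous_action actZ ->
        exists phi : Y -> Z, factor_map actY actZ phi /\ forall x, psi x = phi (pi x)].

(* r_M <= k, i.e. sup_y |pi^{-1}(y)| <= k: every fiber has at most k points. *)
Definition max_rank_le (X : eqType) (Y : Type) (pi : X -> Y) (k : nat) : Prop :=
  forall (y : Y) (s : seq X), uniq s -> (forall x, x \in s -> pi x = y) ->
    (size s <= k)%N.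

(* Main.v *)
Require Import Defs.
From HB Require Import structures.
From mathcomp Require Import all_boot all_order all_algebra.
From mathcomp Require Import all_classical all_reals all_analysis.
From mathcomp Require Import lra.
Import Order.TTheory GRing.Theory Num.Theory.
Import numFieldTopology.Exports numFieldNormedType.Exports.
Local Open Scope classical_set_scope.
Local Open Scope ring_scope.
Set Implicit Arguments.
Unset Strict Implicit.
Unset Printing Implicit Defensive.

(* If (X, G) is not m-equicontinuous, limits of m-tuples pulled apart by the
   action have the same image in the equicontinuous factor, which gives a fiber
   with m points.

   Conversely, let h(x, z) be continuous in x, uniformly in z, where z ranges
   over X^m, and put F(x, z) = sup_g h(g x, g z).  With respect to an invariant
   mean in z, the L^1 distance between F(x, _) and F(x', _) is a continuous
   invariant pseudometric in x (McMahon's argument, with monotone nets of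
   finite maxima in place of measures of closed sets).  It defines an
   equicontinuous factor, so it vanishes when x and x' lie in the same fiber of
   pi.  Taking for h a bump at x times an indicator function shows that one
   coordinate at a time can be moved along a fiber of pi without leaving the
   closure of G.U^m.  As pi(U) has nonempty interior, all m-tuples in a fiber
   lie in that closure: points arbitrarily close to the m given ones can be
   brought into U by a common group element, and m-equicontinuity fails at
   the points of U. *)

(** * Invariant means for actions of abelian groups *)

Definition fbounded (R : realType) (Z : Type) (f : Z -> R) : Prop :=
  exists M : R, forall z, `|f z| <= M.

Definition invariant_mean (R : realType) (H : zmodType) (Z : Type)
    (act : H -> Z -> Z) (L : (Z -> R) -> R) : Prop :=
  [/\ forall c, L (fun=> c) = c,
      forall f g, fbounded f -> fbounded g ->
        L (fun z => f z + g z) = L f + L g,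
      forall f g, fbounded f -> fbounded g -> (forall z, f z <= g z) ->
        L f <= L g &
      forall f h, fbounded f -> L (fun z => f (act h z)) = L f].

Lemma ultrafilter_cvg (I : Type) (T : topologicalType) (U : set_system I)
    (UU : UltraFilter U) (A : set T) (f : I -> T) :
  compact A -> (forall i, A (f i)) -> exists2 p, A p & f @ U --> p.
Proof.
move=> cA fA.
suff FU : UltraFilter (f @ U).
  have := cA; rewrite compact_ultra => /(_ (f @ U) FU).
  case=> [|p [Ap ?]]; last by exists p.
  by apply: (@filterS _ U _ setT (f @^-1` A)) => [i _|];
    [exact: fA|exact: filterT].
split; first exact: fmap_proper_filter.
move=> G GF sG; apply/seteqP; split => // B GB.
have [//|nB] := in_ultra_setVsetC (f @^-1` B) UU.
have : G (B `&` ~` B) by apply: filterI => //; exact: sG.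
by rewrite setICr => /filter_not_empty.
Qed.

(** For each [b] the sum over the progression [h *+ i] telescopes to two terms, so the bound does
    not grow with [n]: averages over long progressions are almost invariant under [h]. *)
Lemma seq_average_telescope (R : realType) (H : zmodType) (Z : Type)
    (act : H -> Z -> Z) (hact : is_action act) (f : Z -> R) (M : R) (z : Z)
    (h : H) (n : nat) (t : seq H) : (forall z, `|f z| <= M) ->
  `|\sum_(c <- [seq h *+ i + b | i <- iota 0 n, b <- t])
      (f (act h (act c z)) - f (act c z))| <= (size t)%:R * (2 * M).
Proof.
move=> fM; rewrite big_allpairs_dep /= exchange_big /=.
apply: le_trans (ler_norm_sum _ _ _) _.
rewrite -[size t]count_predT -sum1_count natr_sum mulr_suml.
apply: ler_sum => b _; rewrite mul1r.
have -> : \sum_(i <- iota 0 n)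
   (f (act h (act (h *+ i + b) z)) - f (act (h *+ i + b) z)) =
   f (act (h *+ n + b) z) - f (act b z).
  have -> : f (act b z) = f (act (h *+ 0 + b) z) by rewrite mulr0n add0r.
  rewrite -(@telescope_sumr _ 0 n (fun i => f (act (h *+ i + b) z)))//.
  rewrite /index_iota subn0; apply: eq_bigr => i _.
  by rewrite -hact.2 addrA mulrS.
rewrite (le_trans (ler_normB _ _))//.
by rewrite mulr_natl mulr2n lerD.
Qed.

(* The averages of f over the finite sequences r of group elements are taken
   along an ultrafilter containing, for every s, the set of the sequences
   s + t; commutativity makes these sets a filter base. *)
Lemma invariant_mean_exists (R : realType) (H : zmodType) (Z : Type)
    (act : H -> Z -> Z) (z : Z) :
  is_action act -> exists L : (Z -> R) -> R, invariant_mean act L.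
Proof.
move=> hact.
pose cv (s t : seq H) := [seq a + b | a <- s, b <- t].
pose avg (f : Z -> R) (r : seq H) := (\sum_(c <- r) f (act c z)) / (size r)%:R.
pose I := {r : seq H | (0 < size r)%N}.
pose mkI r (hr : (0 < size r)%N) : I := exist _ r hr.
pose B (s : I) : set I :=
  [set r | exists t : seq H, perm_eq (val r) (cv (val s) t)].
pose F := filter_from setT B.
have szcv s t : size (cv s t) = (size s * size t)%N by exact: size_allpairs.
have FF : ProperFilter F.
  apply: filter_from_proper; last first.
    move=> s _; exists s, [:: 0]; rewrite /cv.
    have -> : [seq a + b | a <- val s, b <- [:: 0]] = val s; last first.
      exact: perm_refl.
    by elim: (val s) => //= a l ->; rewrite addr0.
  apply: filter_from_filter.
    by exists (mkI [:: 0] isT).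
  move=> s t _ _.
  have st : (0 < size (cv (val s) (val t)))%N.
    by rewrite szcv muln_gt0 (valP s) (valP t).
  exists (mkI _ st) => // r [u /= ru]; split.
  - exists (cv (val t) u); apply: perm_trans ru _; apply/permP => p.
    rewrite -!sum1_count [LHS]big_mkcond [RHS]big_mkcond !big_allpairs_dep /=.
    apply: eq_bigr => a _; rewrite big_allpairs_dep.
    by apply: eq_bigr => b _; apply: eq_bigr => c _; rewrite addrA.
  - exists (cv (val s) u); apply: perm_trans ru _; apply/permP => p.
    rewrite -!sum1_count [LHS]big_mkcond [RHS]big_mkcond !big_allpairs_dep /=.
    rewrite exchange_big /=; apply: eq_bigr => b _; rewrite big_allpairs_dep.
    by apply: eq_bigr => a _; apply: eq_bigr => c _; rewrite addrA (addrC a b).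
have [U [UU FU]] := ultraFilterLemma FF.
have PU : ProperFilter U by exact: ultra_proper.
have fU : Filter U by exact: filter_filter.
have szI (r : I) : 0 < (size (val r))%:R :> R by rewrite ltr0n (valP r).
have avg_cvg f : fbounded f ->
    exists l : R, (fun r : I => avg f (val r)) @ U --> l.
  move=> [M fM].
  have [||p _ ?] := @ultrafilter_cvg I R U UU `[- M, M]%classic
    (fun r : I => avg f (val r)); last by exists p.
    exact: segment_compact.
  move=> r /=; rewrite in_itv /= -ler_norml /avg normrM normfV.
  rewrite (ger0_norm (ltW (szI r))) ler_pdivrMr //.
  apply: le_trans (ler_norm_sum _ _ _) _.
  rewrite -[size _]count_predT -sum1_count natr_sum mulr_sumr.
  by apply: ler_sum => c _; rewrite mulr1.
have {}avg_cvg f : fbounded f ->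
    (fun r : I => avg f (val r)) @ U --> lim ((fun r : I => avg f (val r)) @ U).
  by move=> /avg_cvg [l fl]; exact: cvgP fl.
exists (fun f => lim ((fun r : I => avg f (val r)) @ U)); split.
- move=> c; apply/cvg_lim; first exact: Rhausdorff.
  have -> : (fun r : I => avg (fun=> c) (val r)) = (fun=> c).
    apply/funext => r; rewrite /avg big_const_seq count_predT iter_addr_0.
    by rewrite -(mulr_natr c) mulfK // gt_eqF.
  exact: cvg_cst.
- move=> f g bf bg; apply/cvg_lim; first exact: Rhausdorff.
  have -> : (fun r : I => avg (fun z => f z + g z) (val r)) =
      (fun r : I => avg f (val r)) \+ (fun r : I => avg g (val r)).
    by apply/funext => r /=; rewrite /avg big_split mulrDl.
  by apply: cvgD; exact: avg_cvg.
- move=> f g bf bg fg; rewrite -subr_ge0.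
  have c := cvgB (FF := fU) (avg_cvg _ bg) (avg_cvg _ bf).
  have <- := cvg_lim (@Rhausdorff R) c.
  apply: limr_ge; first exact: cvgP c.
  apply: nearW => r /=; rewrite subr_ge0 /avg ler_pM2r; last first.
    by rewrite invr_gt0; exact: szI.
  exact: ler_sum.
- move=> f h bf.
  have bfh : fbounded (fun z => f (act h z)) by case: bf => M fM; exists M.
  have := cvgB (FF := fU) (avg_cvg _ bfh) (avg_cvg _ bf).
  set D := (X in X @ U --> _) => cD.
  apply/eqP; rewrite -subr_eq0; apply/eqP.
  have := cvg_lim (@Rhausdorff R) cD => <-.
  apply/cvg_lim; first exact: Rhausdorff.
  apply/cvgrPdist_le => e e0.
  have [M fM] := bf.
  (* As [n] exceeds 2M/e, on sequences in [B] of the progression of length [n] the average of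
     [f (act h z) - f z] is at most 2M/n, hence at most [e], in absolute value. *)
  pose n := (Num.truncn (2 * M / e)).+1.
  have n0 : (0 < size [seq h *+ i | i <- iota 0 n])%N.
    by rewrite size_map size_iota.
  apply: (FU); exists (mkI _ n0) => // r [t /= rt]; rewrite sub0r normrN.
  have -> : D r = (\sum_(c <- val r) (f (act h (act c z)) - f (act c z))) /
      (size (val r))%:R.
    transitivity (avg (fun z => f (act h z)) (val r) - avg f (val r)) => //.
    by rewrite /avg -mulrBl -sumrB.
  rewrite normrM normfV (ger0_norm (ltW (szI r))) ler_pdivrMr //.
  rewrite (perm_big _ rt) (perm_size rt) szcv /= size_map size_iota.
  have := @seq_average_telescope R H Z act hact f M z h n t fM.
  rewrite /cv /mkI /= allpairs_mapl => /le_trans; apply.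
  rewrite natrM [X in _ <= X]mulrA [X in _ <= X]mulrC; apply: ler_wpM2l => //.
  rewrite [e * _]mulrC -ler_pdivrMr //; apply: ltW; exact: truncnS_gt.
Qed.

(** * Return times in minimal systems *)

Lemma minimal_visits (G : zmodType) (X : topologicalType) (act : G -> X -> X)
    (U : set X) (x : X) :
  minimal_action act -> open U -> U !=set0 -> exists g, U (act g x).
Proof.
move=> amin oU [u Uu].
have : closure (range (fun g => act g x)) u by rewrite amin.
by move=> /(_ U (open_nbhs_nbhs (conj oU Uu))) [_ [[g _ <-] ?]]; exists g.
Qed.

(** Otherwise the sets of points that no element of [S] brings into [U] form a filter base. It has a
    cluster point by compactness; minimality gives a [g] bringing that point, and a neighborhood of
    it, into [U], against the case [S = [:: g]]. *)
Lemma minimal_syndetic (G : zmodType) (X : topologicalType) (act : G -> X -> X)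
    (U : set X) :
  compact [set: X] -> (forall g, continuous (act g)) -> minimal_action act ->
  open U -> U !=set0 ->
  exists S : seq G, forall x, exists2 g, g \in S & U (act g x).
Proof.
move=> cX cact amin oU U0; apply: contrapT => nS.
pose F := filter_from [set: seq G]
  (fun S => [set x | forall g, g \in S -> ~ U (act g x)]).
have FF : ProperFilter F.
  apply: filter_from_proper => [|S _].
    apply: filter_from_filter; first by exists [::].
    move=> S T _ _; exists (S ++ T) => // x /= H.
    by split=> g gS; apply: H; rewrite mem_cat gS ?orbT.
  apply: contrapT => SN; apply: nS; exists S => x; apply: contrapT => xN.
  by apply: SN; exists x => g gS Ux; apply: xN; exists g.
have [|p [_ Fp]] := cX F FF; first exact: filterT.
have [g Ugp] := minimal_visits p amin oU U0.
have [||q [nU Uq]] := Fp [set x | ~ U (act g x)] (act g @^-1` U).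
- by exists [:: g] => // x /=; apply; rewrite inE.
- by apply: (cact g p); exact: open_nbhs_nbhs.
- exact: nU.
Qed.

(** * The invariant pseudometric built from a mean *)

Lemma fbounded_itv (R : realType) (Z : Type) (f : Z -> R) (b : R) :
  (forall z, 0 <= f z <= b) -> fbounded f.
Proof.
by move=> f01; exists b => z; have /andP[f0 f1] := f01 z; rewrite ger0_norm.
Qed.

Section OrbitSup.
Context (R : realType) (G : zmodType) (X : topologicalType) (Z : Type).
Context (actX : G -> X -> X) (actZ : G -> Z -> Z).
Context (hX : is_action actX) (hZ : is_action actZ).
Context (cX : compact [set: X]) (actX_cont : forall g, continuous (actX g)).
Context (X_minimal : minimal_action actX).
Context (h : X -> Z -> R) (h01 : forall x z, 0 <= h x z <= 1).
Context (h_cont : forall x e, 0 < e ->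
  \forall y \near x, forall z, `|h x z - h y z| <= e).
Context (L : (Z -> R) -> R) (L_mean : invariant_mean actZ L).

(** Finite stages of F(x, z) = sup_g h(g x, g z), increasing in [S]. The base value 0 of the maximum
    is harmless because [h] is nonnegative. *)
Definition orbit_sup (S : seq G) (x : X) (z : Z) : R :=
  \big[Num.max/0]_(g <- S) h (actX g x) (actZ g z).

Lemma orbit_sup_itv S x z : 0 <= orbit_sup S x z <= 1.
Proof.
apply/andP; split; first exact: bigmax_ge_id.
by apply: bigmax_le => // g _; case/andP: (h01 (actX g x) (actZ g z)).
Qed.

Lemma orbit_sup_sub (S T : seq G) x z : {subset S <= T} ->
  orbit_sup S x z <= orbit_sup T x z.
Proof.
move=> ST; rewrite /orbit_sup [X in X <= _]big_seq.
apply: bigmax_le; first exact: bigmax_ge_id.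
by move=> g gS; apply: le_bigmax_seq => //; exact: ST.
Qed.

Lemma orbit_sup_translate S g x z :
  orbit_sup S (actX g x) (actZ g z) = orbit_sup [seq s + g | s <- S] x z.
Proof.
rewrite /orbit_sup big_map; apply: eq_bigr => s _.
by rewrite hX.2 hZ.2.
Qed.

Lemma orbit_sup_cont S x e : 0 < e ->
  \forall y \near x, forall z, `|orbit_sup S x z - orbit_sup S y z| <= e.
Proof.
move=> e0; elim: S => [|g S IH].
  by apply: nearW => y z; rewrite /orbit_sup !big_nil subrr normr0 ltW.
have hg : \forall y \near x, forall z,
    `|h (actX g x) z - h (actX g y) z| <= e.
  exact: (@actX_cont g x _ (@h_cont (actX g x) e e0)).
near=> y => z; rewrite /orbit_sup !big_cons -!/(orbit_sup _ _ _).
have : `|h (actX g x) (actZ g z) - h (actX g y) (actZ g z)| <= e.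
  by move: z; near: y; apply: filterS hg => y + z; exact.
have : `|orbit_sup S x z - orbit_sup S y z| <= e by move: z; near: y.
rewrite !ler_norml !maxEle; do 2![case: ifP] => *; lra.
Unshelve. all: by end_near. Qed.

Definition joint_sup (S : seq G) (x y : X) (z : Z) : R :=
  Num.max (orbit_sup S x z) (orbit_sup S y z).

Lemma joint_sup_itv S x y z : 0 <= joint_sup S x y z <= 1.
Proof.
rewrite /joint_sup; have := orbit_sup_itv S x z; have := orbit_sup_itv S y z.
by rewrite maxEle; case: ifP.
Qed.

Lemma fbounded_joint_sup S x y : fbounded (joint_sup S x y).
Proof. by apply: fbounded_itv => z; exact: joint_sup_itv. Qed.

Let fb := fbounded_joint_sup.

Let L_cst : forall c, L (fun=> c) = c. Proof. by case: L_mean. Qed.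
Let L_add : forall f g, fbounded f -> fbounded g ->
  L (fun z => f z + g z) = L f + L g. Proof. by case: L_mean. Qed.
Let L_le : forall f g, fbounded f -> fbounded g -> (forall z, f z <= g z) ->
  L f <= L g. Proof. by case: L_mean. Qed.
Let L_inv : forall f g, fbounded f -> L (fun z => f (actZ g z)) = L f.
Proof. by case: L_mean. Qed.

Lemma fbounded_add (f g : Z -> R) : fbounded f -> fbounded g ->
  fbounded (fun z => f z + g z).
Proof.
move=> [M fM] [N gN]; exists (M + N) => z.
by rewrite (le_trans (ler_normD _ _))// lerD.
Qed.

Lemma fbounded_cst (c : R) : fbounded (fun _ : Z => c).
Proof. by exists `|c|. Qed.

(* Since |u - v| = 2 max(u, v) - u - v, half the L^1 distance between the
   sections of sup_g h(g x, g z) at x and y is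
   joint_mean x y - joint_mean x x. *)
Definition joint_mean (x y : X) : R :=
  sup (range (fun S : seq G => L (joint_sup S x y))).

Lemma joint_mean_ge S x y : L (joint_sup S x y) <= joint_mean x y.
Proof.
apply: ub_le_sup; last by exists S.
exists 1 => _ [T _ <-]; rewrite -[X in _ <= X](L_cst 1).
apply: L_le; [exact: fb|exact: fbounded_cst|] => z.
by case/andP: (joint_sup_itv T x y z).
Qed.

Lemma joint_mean_le x y c : (forall S, L (joint_sup S x y) <= c) ->
  joint_mean x y <= c.
Proof.
move=> H; apply: ge_sup; first by exists (L (joint_sup [::] x y)), [::].
by move=> _ [S _ <-].
Qed.

Lemma joint_mean_sym x y : joint_mean x y = joint_mean y x.
Proof.
rewrite /joint_mean.
suff jsC S : joint_sup S x y = joint_sup S y x.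
  by congr sup; congr image; apply/funext => S; rewrite jsC.
by apply/funext => z; exact: maxC.
Qed.

(** Translating [z] as well costs nothing under [L]; the translation of both points then becomes one
    of [S], which the supremum over [S] absorbs. *)
Lemma L_joint_sup_translate S g x y :
  L (joint_sup S (actX g x) (actX g y)) =
  L (joint_sup [seq s + g | s <- S] x y).
Proof.
rewrite -(L_inv g (fb S (actX g x) (actX g y))); congr L; apply/funext => z.
by rewrite /joint_sup !orbit_sup_translate.
Qed.

Lemma joint_mean_invariant g x y :
  joint_mean (actX g x) (actX g y) = joint_mean x y.
Proof.
have le g' x' y' : joint_mean (actX g' x') (actX g' y') <= joint_mean x' y'.
  apply: joint_mean_le => S; rewrite L_joint_sup_translate.
  exact: joint_mean_ge.
apply/eqP; rewrite eq_le le /=.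
by have := le (- g) (actX g x) (actX g y); rewrite -!hX.2 addNr !hX.1.
Qed.

Lemma joint_sup_cont S x e : 0 < e ->
  \forall y \near x, `|L (joint_sup S x x) - L (joint_sup S y y)| <= e.
Proof.
move=> e0; near=> y.
have H z : `|orbit_sup S x z - orbit_sup S y z| <= e.
  by move: z; near: y; exact: orbit_sup_cont.
have le x' y' : (forall z, `|orbit_sup S x' z - orbit_sup S y' z| <= e) ->
    L (joint_sup S x' x') <= L (joint_sup S y' y') + e.
  move=> H'; rewrite -[X in _ + X]L_cst -L_add;
    [|exact: fb|exact: fbounded_cst].
  apply: L_le; [exact: fb| |].
    by apply: fbounded_add; [exact: fb|exact: fbounded_cst].
  by move=> z; have := H' z; rewrite /joint_sup !maxxx ler_norml; lra.
have := le _ _ H; have := le y x; rewrite ler_norml => {}le1 le2.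
have {}le1 : L (joint_sup S y y) <= L (joint_sup S x x) + e.
  by apply: le1 => z; rewrite distrC.
by apply/andP; split; lra.
Unshelve. all: by end_near. Qed.

(** The diagonal is invariant and, as a supremum of continuous functions, lower semicontinuous;
    density of all orbits makes such a function constant. *)
Lemma joint_mean_diag x y : joint_mean x x = joint_mean y y.
Proof.
suff le x' y' : joint_mean x' x' <= joint_mean y' y'.
  by apply/eqP; rewrite eq_le !le.
apply: joint_mean_le => S; apply/ler_addgt0Pr => e e0.
have := joint_sup_cont S x' e0; rewrite /prop_near1 nbhsE => -[U [oU Ux'] HU].
have [g Ug] := minimal_visits y' X_minimal oU (ex_intro _ x' Ux').
have := HU _ Ug; rewrite /= ler_norml => H.
have := joint_mean_ge S (actX g y') (actX g y').
by rewrite joint_mean_invariant; lra.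
Qed.

Lemma joint_sup_sub (S T : seq G) x y : {subset S <= T} ->
  L (joint_sup S x y) <= L (joint_sup T x y).
Proof.
move=> ST; apply: L_le; [exact: fb|exact: fb|] => z.
have := orbit_sup_sub x z ST; have := orbit_sup_sub y z ST.
by rewrite /joint_sup !maxEle; do 2![case: ifP] => *; lra.
Qed.

(* A Dini-type argument: minimality and compactness make a single S good at
   every point. *)
Lemma joint_mean_uniform e : 0 < e ->
  exists S, forall x, joint_mean x x - e <= L (joint_sup S x x).
Proof.
move=> e0; have [[x0]|X0] := pselect (exists x0 : X, True); last first.
  by exists [::] => x; exfalso; apply: X0; exists x.
have [S HS] : exists S, joint_mean x0 x0 - e / 2 <= L (joint_sup S x0 x0).
  apply: contrapT => nS.
  have : joint_mean x0 x0 <= joint_mean x0 x0 - e / 2.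
    apply: joint_mean_le => S; rewrite leNgt; apply/negP => /ltW H.
    by apply: nS; exists S.
  by lra.
have e20 : 0 < e / 2 by lra.
have := joint_sup_cont S x0 e20; rewrite /prop_near1 nbhsE => -[U [oU Ux0] HU].
have [T HT] := minimal_syndetic cX actX_cont X_minimal oU (ex_intro _ x0 Ux0).
(* [S] is good on [U] and [T] brings every point into [U], so the sums [s + g] are good
   everywhere. *)
exists [seq s + g | s <- S, g <- T] => x.
have [g gT /HU /=] := HT x; rewrite L_joint_sup_translate ler_norml.
have sub : {subset [seq s + g | s <- S] <= [seq s + g | s <- S, g <- T]}.
  move=> _ /mapP [s sS ->]; apply/allpairsP; by exists (s, g).
have := joint_sup_sub x x sub; rewrite (joint_mean_diag x x0); lra.
Qed.

(** Once the constant diagonal is subtracted, this is the triangle inequality. It integrates max(u,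
    w) + v <= max(u, v) + max(v, w), with [S ++ T] dominating both finite stages. *)
Lemma joint_mean_triangle x y w :
  joint_mean x w + joint_mean y y <= joint_mean x y + joint_mean y w.
Proof.
rewrite -lerBrDr; apply: joint_mean_le => S.
rewrite lerBrDr addrC -lerBrDr; apply: joint_mean_le => T.
rewrite lerBrDr.
have sT : {subset T <= S ++ T} by move=> g; rewrite mem_cat orbC => ->.
have sS : {subset S <= S ++ T} by move=> g; rewrite mem_cat => ->.
have := joint_sup_sub x w sS; have := joint_sup_sub y y sT.
have := joint_mean_ge (S ++ T) x y; have := joint_mean_ge (S ++ T) y w.
suff : L (joint_sup (S ++ T) x w) + L (joint_sup (S ++ T) y y) <=
    L (joint_sup (S ++ T) x y) + L (joint_sup (S ++ T) y w) by lra.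
rewrite -!L_add //; try exact: fb.
apply: L_le; [by apply: fbounded_add; exact: fb..|] => z.
by rewrite /joint_sup !maxEle; do ![case: ifP] => *; lra.
Qed.

(** The neighborhood in [orbit_sup_cont] depends on the index set, so it is taken for one [S] that
    is good at every point. Enlarging [S] by any [T] then adds at most e/3 to the mean at [y]. *)
Lemma joint_mean_cont x e : 0 < e ->
  \forall y \near x, joint_mean x y <= joint_mean x x + e.
Proof.
move=> e0; have e30 : 0 < e / 3 by lra.
have [S HS] := joint_mean_uniform e30; near=> y.
have H z : `|orbit_sup S x z - orbit_sup S y z| <= e / 3.
  by move: z; near: y; exact: orbit_sup_cont.
apply: joint_mean_le => T.
have sT : {subset T <= S ++ T} by move=> g; rewrite mem_cat orbC => ->.
have sS : {subset S <= S ++ T} by move=> g; rewrite mem_cat => ->.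
have := joint_sup_sub x y sT.
have := HS x; have := HS y; rewrite (joint_mean_diag y x).
have := joint_mean_ge (S ++ T) x x; have := joint_mean_ge (S ++ T) y y.
rewrite (joint_mean_diag y x).
(* With u, v the values at [x], [y] for [S], and u', v' those for [S ++ T]: max(u', v') + v <= u' +
   v' + e/3, as v <= v' and v <= u + e/3 <= u' + e/3. *)
suff : L (joint_sup (S ++ T) x y) + L (joint_sup S y y) <=
   L (joint_sup (S ++ T) x x) + (L (joint_sup (S ++ T) y y) + e / 3) by lra.
have fbe := fbounded_add (fb (S ++ T) y y) (fbounded_cst (e / 3)).
rewrite -[X in _ + (_ + X)]L_cst -(L_add (fb _ y y) (fbounded_cst _)).
rewrite -(L_add (fb _ x x) fbe) -(L_add (fb (S ++ T) x y) (fb S y y)).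
apply: L_le => [||z]; [exact: fbounded_add|exact: fbounded_add|].
have := H z; have := orbit_sup_sub x z sS; have := orbit_sup_sub y z sS.
by rewrite ler_norml /joint_sup !maxEle; do ![case: ifP] => *; lra.
Unshelve. all: by end_near. Qed.

End OrbitSup.

(** * Equicontinuous factors from invariant pseudometrics *)

Section MetricQuotient.
Context (R : realType) (X : choiceType) (d : X -> X -> R).
Context (d0 : forall x, d x x = 0) (d_sym : forall x y, d x y = d y x).
Context (d_triangle : forall y x z, d x z <= d x y + d y z).

(** A canonical point of the zero-distance class of [x]; the fixed points of [rep] realize the
    quotient as a subtype of [X]. *)
Let rep (x : X) : X := choose [pred y | d x y == 0] x.

Let rep_eq0 x : d x (rep x) = 0.
Proof.
by apply/eqP; apply: (@chooseP _ [pred y | d x y == 0]); rewrite /= d0.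
Qed.

Let d_ge0 x y : 0 <= d x y.
Proof. by have := d_triangle y x x; rewrite d0 (d_sym y x); lra. Qed.

Let rep_class x y : d x y = 0 -> rep x = rep y.
Proof.
move=> xy; rewrite /rep.
rewrite (@eq_choose _ [pred z | d x z == 0] [pred z | d y z == 0]).
  by apply: choose_id; rewrite /= ?d0// d_sym xy.
move=> z /=; have := d_triangle y x z; have := d_triangle x y z.
have := d_ge0 x z; have := d_ge0 y z; rewrite (d_sym y x) xy => *.
by apply/eqP/eqP; lra.
Qed.

Let quotient : Type := {x : X | rep x == x}.
HB.instance Definition _ := Choice.on quotient.

Let qdist (p q : quotient) : R := d (val p) (val q).

Let qdistxx p : qdist p p = 0. Proof. exact: d0. Qed.
Let qdist_positivity p q : qdist p q = 0 -> p = q.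
Proof.
move=> /rep_class pq; apply: val_inj.
by rewrite -(eqP (valP p)) pq (eqP (valP q)).
Qed.
Let qdist_sym p q : qdist p q = qdist q p. Proof. exact: d_sym. Qed.
Let qdist_triangle q p r : qdist p r <= qdist p q + qdist q r.
Proof. exact: d_triangle. Qed.

HB.instance Definition _ := isMetric.Build R quotient
  qdistxx qdist_positivity qdist_sym qdist_triangle.

Lemma metric_quotient : exists (Q : metricType R) (p : X -> Q),
  (forall q, exists x, p x = q) /\ forall x y, mdist (p x) (p y) = d x y.
Proof.
have rep_id x : rep (rep x) == rep x.
  by apply/eqP; rewrite -(@rep_class x (rep x)).
exists quotient, (fun x => exist _ (rep x) (rep_id x)); split.
  move=> [x rx]; exists x; apply: val_inj => /=; exact/eqP.
move=> x y; change (d (rep x) (rep y) = d x y).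
have := d_triangle x (rep x) (rep y); have := d_triangle y x (rep y).
have := d_triangle (rep x) x y; have := d_triangle (rep y) (rep x) y.
by rewrite (d_sym (rep x) x) (d_sym (rep y) y) !rep_eq0; lra.
Qed.

End MetricQuotient.

Section PseudometricFactor.
Import metricType_numDomainType.

Lemma pseudometric_factor (R : realType) (G : topologicalZmodType)
    (X : topologicalType) (act : G -> X -> X) (d : X -> X -> R) :
  continuous_action act ->
  (forall x, d x x = 0) -> (forall x y, d x y = d y x) ->
  (forall y x z, d x z <= d x y + d y z) ->
  (forall g x y, d (act g x) (act g y) = d x y) ->
  (forall x e, 0 < e -> \forall y \near x, d x y < e) ->
  exists (Q : metricType R) (actQ : G -> Q -> Q) (p : X -> Q),
    [/\ continuous_action actQ, factor_map act actQ p,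
        equicontinuous_action actQ & forall x y, mdist (p x) (p y) = d x y].
Proof.
move=> [[act0 actD] actC] d0 ds dt dg dc.
have [Q [p [psurj pd]]] := metric_quotient d0 ds dt.
have [s sK] := choice psurj.
pose actQ g q := p (act g (s q)).
have actQp g x : actQ g (p x) = p (act g x).
  by apply: mdist_positivity; rewrite pd dg -pd sK mdistxx.
exists Q, actQ, p; split => //.
- split; first split.
  + by move=> q; rewrite -(sK q) actQp act0.
  + by move=> g h q; rewrite -(sK q) !actQp actD.
  + move=> [g q]; apply/cvgrPdist_lt => e e0.
    have e20 : 0 < e / 2 by lra.
    have gx : \forall g' \near g, d (act g (s q)) (act g' (s q)) < e / 2.
      have cg : (fun g' => act g' (s q)) @ g --> act g (s q).
        apply: (@continuous_comp _ _ _ (fun g' => (g', s q))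
          (fun p : G * X => act p.1 p.2)); last exact: actC.
        by apply: cvg_pair; [exact: cvg_id|exact: cvg_cst].
      exact: cg _ (dc _ _ e20).
    have qq : \forall q' \near q, mdist q q' < e / 2.
      by have /cvgrPdist_lt := @cvg_id _ (nbhs q); apply.
    (* The first set controls the change of group element at the fixed point [s q], the second the
       change of point, because [act g'] preserves [d]. *)
    exists ([set g' | d (act g (s q)) (act g' (s q)) < e / 2],
      [set q' | mdist q q' < e / 2]); first by split.
    move=> [g' q'] /= [H1 H2]; rewrite /actQ pd.
    apply: le_lt_trans (dt (act g' (s q)) _ _) _.
    by move: H1 H2; rewrite dg -(pd (s q) (s q')) !sK; lra.
- split=> //; move=> x; apply/cvgrPdist_lt => e e0.
  by near=> y; rewrite pd; near: y; exact: dc.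
- move=> q e e0; exists e => // q' qq' g.
  by rewrite pd dg -pd !sK.
Unshelve. all: by end_near. Qed.

End PseudometricFactor.

(** * Moving one point along a fiber *)

(** Finitely many preimages of [W] cover [Z], so their indicators sum to at least 1, while by
    invariance the mean of this sum is [size S] times that of [W]. *)
Lemma invariant_mean_gt0 (R : realType) (H : zmodType) (Z : Type)
    (act : H -> Z -> Z) (L : (Z -> R) -> R) (W : set Z) (S : seq H) :
  invariant_mean act L -> (forall z, exists2 g, g \in S & W (act g z)) ->
  0 < L (fun z => (z \in W)%:R).
Proof.
move=> [Lc La Ll Li] HS; set c := L _.
have bW : fbounded (fun z => (z \in W)%:R : R).
  by apply: (@fbounded_itv _ _ _ 1) => z; case: (z \in W); rewrite ?lexx ?ler01.
have [bS LS] : fbounded (fun z => \sum_(g <- S) (act g z \in W)%:R : R) /\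
    L (fun z => \sum_(g <- S) (act g z \in W)%:R) = (size S)%:R * c.
  elim: {HS} S => [|g S [bS IH]].
    under eq_fun do rewrite big_nil.
    by rewrite Lc mul0r; split => //; exact: fbounded_cst.
  have bg : fbounded (fun z => (act g z \in W)%:R : R).
    by case: bW => M WM; exists M => z; exact: WM.
  under eq_fun do rewrite big_cons.
  split; first exact: fbounded_add.
  rewrite (La _ _ bg bS) IH (Li _ g bW) -/c.
  by rewrite /= -natr1 mulrDl mul1r addrC.
have : 1 <= (size S)%:R * c.
  rewrite -LS -[X in X <= _](Lc 1); apply: Ll => // [|z].
    exact: fbounded_cst.
  have [g gS Wg] := HS z.
  rewrite (big_rem g) //= mem_set // lerDl.
  by apply: sumr_ge0 => *; exact: ler0n.
apply: contraTT; rewrite -leNgt -ltNge => c0.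
by rewrite (le_lt_trans (mulr_ge0_le0 _ c0)).
Qed.

Section FiberTransfer.
Context (R : realType) (G : topologicalZmodType) (X : metricType R).
Context (act : G -> X -> X) (cX : compact [set: X]).
Context (actC : continuous_action act) (amin : minimal_action act).
Context (Y : metricType R) (actY : G -> Y -> Y) (pi : X -> Y).
Context (pi_max : max_equicontinuous_factor act actY pi).

Lemma continuous_action_at g : continuous (act g).
Proof.
move=> x; apply: (@continuous_comp _ _ _ (fun y => (g, y))
  (fun p : G * X => act p.1 p.2)); last exact: actC.2.
by apply: cvg_pair; [exact: cvg_cst|exact: cvg_id].
Qed.

(** By maximality, the projection to the equicontinuous factor defined by [d] factors through
    [pi]. *)
Lemma fiber_pseudometric0 (d : X -> X -> R) x y :
  (forall x, d x x = 0) -> (forall x y, d x y = d y x) ->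
  (forall y x z, d x z <= d x y + d y z) ->
  (forall g x y, d (act g x) (act g y) = d x y) ->
  (forall x e, 0 < e -> \forall y \near x, d x y < e) ->
  pi x = pi y -> d x y = 0.
Proof.
move=> d0 ds dt dg dc xy.
have [Q [actQ [p [Qc Qf Qe pd]]]] := pseudometric_factor actC d0 ds dt dg dc.
case: pi_max => _ _ _ /(_ Q actQ p Qc Qf Qe) [phi [_ pE]].
by rewrite -pd !pE xy mdistxx.
Qed.

Let tent (x : X) (r : R) (y : X) : R := Num.max 0 (1 - mdist x y / r).

Let tent_lip x r y y' : 0 < r -> `|tent x r y - tent x r y'| <= mdist y y' / r.
Proof.
move=> r0.
have : mdist x y / r <= mdist x y' / r + mdist y y' / r.
  by rewrite -mulrDl ler_pM2r ?invr_gt0// (metric_sym y) metric_triangle.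
have : mdist x y' / r <= mdist x y / r + mdist y y' / r.
  by rewrite -mulrDl ler_pM2r ?invr_gt0// metric_triangle.
have : 0 <= mdist y y' / r by rewrite divr_ge0 ?mdist_ge0// ltW.
by rewrite /tent ler_norml !maxEle; do ![case: ifP] => *; lra.
Qed.

(** If there were no such [g] and [z], take for [h] a bump at [x] vanishing outside [U] times the
    indicator of [A]. For z in [W], sup_g h(g x', g z) is 0, while sup_g h(g x, g z) is 1, already
    at g = 0. The two sections would be at positive L^1 distance, though [x] and [x'] share a
    fiber. *)
Lemma fiber_transfer (Z : Type) (actZ : G -> Z -> Z) (L : (Z -> R) -> R)
    (x x' : X) (U : set X) (W A : set Z) :
  is_action actZ -> invariant_mean actZ L ->
  pi x = pi x' -> open U -> U x -> W `<=` A -> 0 < L (fun z => (z \in W)%:R) ->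
  exists g z, [/\ W z, U (act g x') & A (actZ g z)].
Proof.
move=> actZA Lm xx' oU Ux WA L0; set c := L _ in L0.
apply: contrapT => noz.
have [r r0 rU] : exists2 r, 0 < r & forall y, mdist x y < r -> U y.
  have : nbhs x U by exact: open_nbhs_nbhs.
  rewrite -filter_from_ballE => -[r r0 rU]; exists r => // y xy.
  by apply: rU; rewrite ballEmdist.
pose h y z : R := tent x r y * (z \in A)%:R.
have h01 y z : 0 <= h y z <= 1.
  have : 0 <= tent x r y <= 1.
    have : 0 <= mdist x y / r by rewrite divr_ge0 ?mdist_ge0// ltW.
    by rewrite /tent maxEle; case: ifP; lra.
  by rewrite /h; case: (z \in A); rewrite ?mulr0 ?mulr1 ?lexx ?ler01.
have h_cont y e : 0 < e -> \forall y' \near y, forall z, `|h y z - h y' z| <= e.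
  move=> e0; have re : 0 < e * r by exact: mulr_gt0.
  have : \forall y' \near y, ball y (e * r) y' by exact: nbhsx_ballx.
  apply: filterS => y'; rewrite ballEmdist /= => yy' z.
  rewrite /h -mulrBl normrM.
  have : `|tent x r y - tent x r y'| <= e.
    by apply: le_trans (tent_lip x y y' r0) _; rewrite ler_pdivrMr// ltW.
  by case: (z \in A); rewrite ?normr0 ?mulr0 ?normr1 ?mulr1 // => _; exact: ltW.
pose jm := joint_mean act actZ h L.
have actXA := actC.1; have cact := continuous_action_at.
have jm_diag := joint_mean_diag actXA actZA cact amin h01 h_cont Lm.
have jmxx' : jm x x' = jm x x.
  suff : jm x x' - jm x x = 0 by lra.
  apply: (@fiber_pseudometric0 (fun y y' => jm y y' - jm y y)) => //.
  - by move=> y; rewrite subrr.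
  - move=> y y'; rewrite /jm (joint_mean_sym act actZ h L y y').
    by rewrite (jm_diag y y').
  - move=> y u w; have := joint_mean_triangle act h01 Lm u y w; rewrite -/jm.
    by rewrite /jm; lra.
  - by move=> g y y'; rewrite /jm !(joint_mean_invariant actXA actZA h01 Lm).
  - move=> y e e0; have e20 : 0 < e / 2 by lra.
    have := joint_mean_cont actXA actZA cX cact amin h01 h_cont Lm y e20.
    by apply: filterS => y'; rewrite -/jm /jm; lra.
have c20 : 0 < c / 2 by lra.
have [S HS] :=
  joint_mean_uniform actXA actZA cX cact amin h01 h_cont Lm c20.
(* Adding 0 to [S] makes the value 1 at [x] appear in the finite stage; the gap [c] on [W] then
   exceeds the error c/2. *)
have sS : {subset S <= 0 :: S} by move=> g; rewrite inE orbC => ->.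
have := joint_sup_sub act h01 Lm x' x' sS; have := HS x'.
have := joint_mean_ge act h01 Lm (0 :: S) x x'; rewrite -/(jm x x') jmxx'.
rewrite /jm (jm_diag x x').
suff : L (joint_sup act actZ h (0 :: S) x' x') + c <=
  L (joint_sup act actZ h (0 :: S) x x') by lra.
case: (Lm) => _ La Ll _.
have bW : fbounded (fun z => (z \in W)%:R : R).
  by apply: (@fbounded_itv _ _ _ 1) => z; case: (z \in W); rewrite ?lexx ?ler01.
have fb := fbounded_joint_sup act actZ h01.
rewrite -(La _ _ (fb _ _ _) bW); apply: Ll => [||z].
- by apply: fbounded_add.
- exact: fb.
have [|zW] := boolP (z \in W); rewrite /joint_sup maxxx; last first.
  by rewrite addr0 le_max lexx orbT.
rewrite inE => Wz.
have -> : orbit_sup act actZ h (0 :: S) x' z = 0.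
  apply/eqP; rewrite eq_le bigmax_ge_id andbT; apply: bigmax_le => // g _.
  rewrite /h; have [|_] := boolP (actZ g z \in A); last by rewrite mulr0.
  rewrite inE => Az; rewrite mulr1 /tent ge_max lexx leNgt; apply/negP.
  rewrite subr_gt0 ltr_pdivrMr // mul1r => /rU Ug.
  by apply: noz; exists g, z.
rewrite add0r le_max; apply/orP; left.
rewrite /orbit_sup big_cons le_max actXA.1 actZA.1 /h.
rewrite mem_set ?mulr1; last exact: WA.
by rewrite /tent mdistxx mul0r subr0 le_max lexx orbT.
Qed.

End FiberTransfer.

(** * Bringing tuples of a fiber into an open set *)

(** Finitely many translates of the closed set pi(C), with [C] a smaller closed neighborhood inside
    [U], cover [Y]; finitely many closed sets with empty interior could not. *)
Lemma factor_image_interior (R : realType) (G : zmodType) (X Y : metricType R)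
    (act : G -> X -> X) (actY : G -> Y -> Y) (pi : X -> Y) (U : set X) :
  compact [set: X] -> (forall g, continuous (act g)) -> minimal_action act ->
  is_action actY -> (forall g, continuous (actY g)) ->
  factor_map act actY pi -> open U -> U !=set0 ->
  exists V : set Y, [/\ open V, V !=set0 & V `<=` pi @` U].
Proof.
move=> cX cact amin [actY0 actYD] cactY [cpi spi epi] oU [x Ux].
have [r r0 rU] : exists2 r, 0 < r & ball x r `<=` U.
  have : nbhs x U by exact: open_nbhs_nbhs.
  by rewrite -filter_from_ballE => -[r r0 rU]; exists r.
have r20 : 0 < r / 2 by lra.
pose C := closure (ball x (r / 2)).
have CU : C `<=` U.
  move=> y Cy; apply: rU.
  have [z [xz yz]] := Cy _ (nbhsx_ballx y _ r20).
  by rewrite [r]splitr; apply: ball_triangle xz _; exact: ball_sym.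
have cK : closed (pi @` C).
  apply: compact_closed; first exact: metric_hausdorff.
  apply: continuous_compact; first exact: continuous_subspaceT.
  by apply: subclosed_compact cX _ => //; exact: closed_closure.
exists (pi @` C)°; split; [exact: open_interior| |]; last first.
  by apply: subset_trans (interior_subset (A := _)) _; exact: image_subset.
apply: contrapT => K0.
have dK g : dense (actY g @^-1` (~` (pi @` C))).
  move=> O [y Oy] oO; apply: contrapT => ON; apply: K0; exists (actY g y).
  rewrite /interior nbhsE; exists (actY (- g) @^-1` O); first split.
  - by apply: open_comp => // z _; exact: cactY.
  - by rewrite /= -actYD addNr actY0.
  - move=> z Oz; apply: contrapT => Kz; apply: ON; exists (actY (- g) z).
    by split => //=; rewrite -actYD subrr actY0.
have [S HS] := minimal_syndetic cX cact amin (open_interior (ball x (r / 2)))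
  (ex_intro _ x (nbhsx_ballx x _ r20)).
have dS (T : seq G) :
    dense [set y | forall g, g \in T -> ~ (pi @` C) (actY g y)].
  elim: T => [|g T IH]; first by move=> O [y Oy] _; exists y.
  suff -> : [set y | forall h, h \in g :: T -> ~ (pi @` C) (actY h y)] =
      actY g @^-1` (~` (pi @` C)) `&`
      [set y | forall h, h \in T -> ~ (pi @` C) (actY h y)].
    apply: denseI => //; apply: open_comp => [z _|]; first exact: cactY.
    exact: closed_openC.
  apply/seteqP; split=> y /= H.
    by split=> [|h hT]; apply: H; rewrite inE ?eqxx// hT orbT.
  by move=> h; rewrite inE => /predU1P[->|hT]; [exact: H.1|exact: H.2].
have [|y [_ /= Hy]] := dS S setT _ openT; first by exists (pi x).
have [z zy] := spi y; have [g gS gz] := HS z.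
apply: (Hy g gS); exists (act g z); last by rewrite epi zy.
by apply: subset_closure; exact: interior_subset gz.
Qed.

(* The mean is invariant even under the coordinatewise action of G^I, which
   makes it positive on every box. *)
Lemma box_mean (R : realType) (G : zmodType) (X : topologicalType)
    (act : G -> X -> X) (I : finType) (p : I -> X) :
  is_action act -> compact [set: X] -> (forall g, continuous (act g)) ->
  minimal_action act ->
  exists2 L : ((I -> X) -> R) -> R,
    invariant_mean (fun g (z : I -> X) i => act g (z i)) L &
    forall O : I -> set X, (forall i, open (O i)) -> (forall i, O i !=set0) ->
      0 < L (fun z => (z \in [set z | forall i, O i (z i)])%:R).
Proof.
move=> [act0 actD] cX cact amin.
pose actI (k : {ffun I -> G}) (z : I -> X) := fun i => act (k i) (z i).
have actIA : is_action actI.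
  split=> [z|k l z]; apply/funext => i; first by rewrite /actI ffunE act0.
  by rewrite /actI ffunE actD.
have [L Lm] := @invariant_mean_exists R _ _ actI p actIA.
exists L => [|O oO O0].
  case: Lm => ? ? ? Li; split => // f h bf.
  have actIE : actI [ffun=> h] = fun z i => act h (z i).
    by apply/funext => z; apply/funext => i; rewrite /actI ffunE.
  by have := Li f [ffun=> h] bf; rewrite actIE.
have /choice[S HS] : forall i, exists S : seq G,
    forall x, exists2 g, g \in S & O i (act g x).
  by move=> i; exact: minimal_syndetic.
pose T := flatten [seq S i | i <- enum I].
(* All tuples with entries in [T]: each coordinate can be brought into its [O i] by some entry of
   [T]. *)
pose K := [seq [ffun i => nth 0 T (c i)] | c : {ffun I -> 'I_(size T)} ].
apply: (invariant_mean_gt0 (S := K) Lm) => z.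
have /choice[c Hc] : forall i, exists c : 'I_(size T),
    O i (act (nth 0 T c) (z i)).
  move=> i; have [g gS Og] := HS i (z i).
  have gT : g \in T by apply/flatten_mapP; exists i; rewrite ?mem_enum.
  have := gT; rewrite -index_mem => lt.
  by exists (Ordinal lt); rewrite /= nth_index.
exists [ffun i => nth 0 T (c i)].
  apply/mapP; exists [ffun i => c i]; first by rewrite mem_enum.
  by apply/ffunP => i; rewrite !ffunE.
by move=> i; rewrite /actI ffunE.
Qed.

(** The points have to move slightly within [O], because bringing one coordinate into [U] perturbs
    the others. *)
Lemma fiber_tuple_proximal (R : realType) (G : topologicalZmodType)
    (X : metricType R) (act : G -> X -> X) (Y : metricType R)
    (actY : G -> Y -> Y) (pi : X -> Y) (m : nat) (U : set X) (p : 'I_m -> X)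
    (y : Y) (O : 'I_m -> set X) :
  compact [set: X] -> continuous_action act -> minimal_action act ->
  max_equicontinuous_factor act actY pi ->
  open U -> U !=set0 -> (forall i, pi (p i) = y) ->
  (forall i, nbhs (p i) (O i)) ->
  exists (q : 'I_m -> X) g, forall i, O i (q i) /\ U (act g (q i)).
Proof.
move=> cX actC amin pi_max oU U0 piy Op.
have cact := continuous_action_at actC.
have [actYC fpi _ _] := pi_max.
have cactY := continuous_action_at actYC.
have [cpi spi epi] := fpi.
have [act0 actD] := actC.1.
have [V [oV [v Vv] VU]] :=
  factor_image_interior cX cact amin actYC.1 cactY fpi oU U0.
have oD : open (pi @^-1` V) by apply: open_comp => // z _; exact: cpi.
(* Coordinates below [k] are only known to lie over [V]; the others are already in [U]. The
   induction on [k] treats one coordinate at a time. *)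
pose B k (i : 'I_m) := if (i < k)%N then pi @^-1` V else U.
have main k : (k <= m)%N -> forall (q : 'I_m -> X) (N : 'I_m -> set X),
    (forall i, B k i (q i)) -> (forall i, nbhs (q i) (N i)) ->
    exists (q' : 'I_m -> X) g, forall i, N i (q' i) /\ U (act g (q' i)).
  elim: k => [_ q N qB qN|k IH km q N qB qN].
    by exists q, 0 => i; rewrite act0; split; [exact: nbhs_singleton|exact: qB].
  pose j := Ordinal km.
  have [x Ux xq] : (pi @` U) (pi (q j)).
    by apply: VU; have := qB j; rewrite /B ltnSn.
  have [L Lm Lpos] := box_mean R q actC.1 cX cact amin.
  (* Coordinate [j] of the tuple [z] is left free, since [q1] below puts [q j] itself there. *)
  pose A i := if i == j then setT else B k i.
  have oA i : open (A i).
    by rewrite /A /B; case: ifP => _; [exact: openT|case: ifP].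
  have qA i : A i (q i).
    rewrite /A; case: eqP => // /eqP ij.
    have := qB i; rewrite /B ltnS leq_eqVlt.
    by rewrite (_ : (i == k :> nat) = false) //; apply/negbTE.
  pose W i := (N i)° `&` A i.
  have actA : is_action (fun g (z : 'I_m -> X) i => act g (z i)).
    by split=> [z|g h z]; apply/funext => i; rewrite ?act0 ?actD.
  have [||g [z [Wz Ugq Az]]] := @fiber_transfer _ _ _ act cX actC amin _ actY pi
    pi_max _ _ L x (q j) U [set z | forall i, W i (z i)]
    [set z | forall i, A i (z i)] actA Lm xq oU Ux.
  - by move=> z Wz i; exact: (Wz i).2.
  - apply: Lpos => i; first by apply: openI; [exact: open_interior|exact: oA].
    by exists (q i); split; [exact: qN|exact: qA].
  pose q1 i := if i == j then q j else z i.
  have [||q' [g' Hq']] := IH (ltnW km) (fun i => act g (q1 i))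
    (fun i => act (- g) @^-1` N i).
  - move=> i; rewrite /q1; have := Az i; rewrite /A; case: eqP => // -> _.
    by rewrite /B ltnn.
  - move=> i; apply: (cact (- g) (act g (q1 i))); rewrite -actD addNr act0 /q1.
    by case: eqP => [->|_]; [exact: qN|exact: (Wz i).1].
  exists (fun i => act (- g) (q' i)), (g' + g) => i.
  by have [? ?] := Hq' i; split => //; rewrite -actD addrK.
have [x xv] := spi v.
have [m0|m0] := posnP m.
  by exists p, 0 => i; have := ltn_ord i; rewrite [X in (_ < X)%N]m0.
(* One [g] serves all coordinates, as the points [p i] have the same image in [Y]. *)
have [g Dg] : exists g, (pi @^-1` V) (act g (p (Ordinal m0))).
  by apply: minimal_visits => //; exists x; rewrite /= xv.
have [||q [g' Hq]] := main m (leqnn _) (fun i => act g (p i))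
    (fun i => act (- g) @^-1` O i).
- by move=> i; rewrite /B ltn_ord /= epi piy -(piy (Ordinal m0)) -epi.
- by move=> i; apply: (cact (- g) (act g (p i))); rewrite -actD addNr act0.
exists (fun i => act (- g) (q i)), (g' + g) => i.
by have [? ?] := Hq i; split => //; rewrite -actD addrK.
Qed.

(** * The two implications *)

Lemma max_rank_of_m_equicontinuous (R : realType) (G : topologicalZmodType)
    (X : metricType R) (act : G -> X -> X) (Y : metricType R)
    (actY : G -> Y -> Y) (pi : X -> Y) (m : nat) :
  compact [set: X] -> continuous_action act -> minimal_action act ->
  max_equicontinuous_factor act actY pi -> (0 < m)%N ->
  m_equicontinuous m act -> max_rank_le pi m.-1.
Proof.
move=> cX actC amin pi_max m0 meq y s us sy; rewrite leqNgt; apply/negP.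
rewrite prednK // => ms.
have [act0 actD] := actC.1.
case: s us sy ms => [|x0 s] us sy ms; first by case: m m0 ms {meq}.
pose p (i : 'I_m) := nth x0 (x0 :: s) i.
have pm (i : 'I_m) : (i < size (x0 :: s))%N by exact: leq_trans (ltn_ord i) ms.
have ppi i : pi (p i) = y by apply: sy; exact: mem_nth.
(* A lower bound for all pairwise distances; the base value 1 keeps it positive when m = 1 leaves no
   pair. *)
pose e := \big[Num.min/1]_(ij : 'I_m * 'I_m | ij.1 != ij.2)
  mdist (p ij.1) (p ij.2).
have e0 : 0 < e.
  apply: lt_bigmin => // -[i j] /= ij.
  by rewrite mdist_gt0 /p nth_uniq.
have e_le i j : i != j -> e <= mdist (p i) (p j).
  by move=> ij; exact: (bigmin_le_cond _ (j := (i, j))).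
have e30 : 0 < e / 3 by lra.
have [d d0 Hd] := meq x0 (e / 3) e30.
have [|i|q [g Hq]] := fiber_tuple_proximal (O := fun i => ball (p i) (e / 3))
  cX actC amin pi_max (open_interior (ball x0 d)) _ ppi.
- by exists x0; exact: nbhsx_ballx.
- exact: nbhsx_ballx.
(* [- g] sends the tuple in the ball around [x0] back to [q]. Two entries of [q] at distance below
   e/3, each within e/3 of its [p i], would contradict the choice of [e]. *)
have [|i [j [ij]]] := Hd (fun i => act g (q i)) _ (- g).
  by move=> i; have := interior_subset (Hq i).2; rewrite ballEmdist.
rewrite -!actD addNr !act0; apply/negP; rewrite -leNgt.
have := (Hq i).1; have := (Hq j).1; rewrite !ballEmdist /= => pj pi'.
have := e_le _ _ ij; have := metric_triangle (p i) (q i) (p j).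
have := metric_triangle (q i) (q j) (p j); rewrite (metric_sym (q j)).
lra.
Qed.

Section MaxRankEquicontinuous.
Import metricType_numDomainType.

Lemma m_equicontinuous_of_max_rank (R : realType) (G : zmodType)
    (X : metricType R) (act : G -> X -> X) (Y : metricType R)
    (actY : G -> Y -> Y) (pi : X -> Y) (m : nat) :
  compact [set: X] -> factor_map act actY pi -> equicontinuous_action actY ->
  (0 < m)%N -> max_rank_le pi m.-1 -> m_equicontinuous m act.
Proof.
move=> cX [cpi spi epi] eqY m0 rk x e e0; apply: contrapT => nd.
have uE : forall n : nat, exists u : ('I_m -> X) * G,
    (forall i, mdist x (u.1 i) < n.+1%:R^-1) /\
    forall i j, i != j -> e <= mdist (act u.2 (u.1 i)) (act u.2 (u.1 j)).
  move=> n; apply: contrapT => nu; apply: nd; exists n.+1%:R^-1 => // xs Hxs g.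
  apply: contrapT => nij; apply: nu; exists (xs, g); split=> // i j ij.
  by rewrite leNgt; apply/negP => lt; apply: nij; exists i, j.
have [u Hu] := choice uE.
(* An ultrafilter finer than the eventual filter makes all [m] coordinates converge at once, without
   extracting subsequences. *)
have [U [UU Uoo]] := ultraFilterLemma (eventually_filter).
have PU : ProperFilter U by exact: ultra_proper.
have fU : Filter U by exact: filter_filter.
pose w i n : X := act (u n).2 ((u n).1 i).
have qE i : exists q : X, w i @ U --> q.
  by have [|q] := ultrafilter_cvg UU (f := w i) cX; last by exists q.
have [q Hq] := choice qE.
have qinj : injective q.
  move=> i j qij; apply: contrapT => /eqP ij.
  have e20 : 0 < e / 2 by lra.
  have [n [/= Hi Hj]] := filter_ex
    (filterI (cvgr_dist_lt (Hq i) e20) (cvgr_dist_lt (Hq j) e20)).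
  have := (Hu n).2 i j ij; have := metric_triangle (w i n) (q i) (w j n).
  by move: Hi Hj; rewrite -qij (metric_sym (w i n) (q i)) /w; lra.
have qpi i j : pi (q i) = pi (q j).
  apply: mdist_positivity; apply/eqP; rewrite eq_le mdist_ge0 andbT.
  apply/ler_addgt0Pr => eta eta0; rewrite add0r.
  (* Four legs below eta/4 lead from [pi (q i)] to [b], [a], [c] and [pi (q j)]; the middle two are
     short by equicontinuity at [pi x]. *)
  have eta40 : 0 < eta / 4 by lra.
  have [d d0 Hd] := eqY (pi x) _ eta40.
  have xd : \forall x' \near x, mdist (pi x) (pi x') < d.
    exact: (cvgr_dist_lt (cpi x) d0).
  have [r /= r0 rd] : exists2 r, 0 < r &
      forall x', mdist x x' < r -> mdist (pi x) (pi x') < d.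
    move: xd; rewrite /prop_near1 -filter_from_ballE => -[r r0 rd].
    exists r => // x' xx'.
    by apply: rd; rewrite ballEmdist.
  have Un : U [set n | n.+1%:R^-1 < r].
    by apply: Uoo; near=> n; near: n; exact: near_infty_natSinv_lt (PosNum r0).
  have piq k : (fun n => pi (w k n)) @ U --> pi (q k).
    exact: (cvg_comp _ _ (Hq k) (cpi (q k))).
  have [n [/= Hn [/= Hi Hj]]] := filter_ex (filterI Un
    (filterI (cvgr_dist_lt (piq i) eta40) (cvgr_dist_lt (piq j) eta40))).
  pose a := actY (u n).2 (pi x); pose b := pi (w i n); pose c := pi (w j n).
  have close k : mdist a (pi (w k n)) < eta / 4.
    by rewrite /w epi; apply: Hd; apply: rd; exact: lt_trans ((Hu n).1 k) Hn.
  have ab : mdist a b < eta / 4 := close i.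
  have ac : mdist a c < eta / 4 := close j.
  have ib : mdist (pi (q i)) b < eta / 4 := Hi.
  have jc : mdist (pi (q j)) c < eta / 4 := Hj.
  have := metric_triangle (pi (q i)) b (pi (q j)).
  have := metric_triangle b c (pi (q j)); have := metric_triangle b a c.
  by rewrite (metric_sym b a) (metric_sym c); lra.
have := rk (pi (q (Ordinal m0))) [seq q i | i <- enum 'I_m].
rewrite map_inj_uniq // enum_uniq size_map size_enum_ord.
suff qfib z : z \in [seq q i | i <- enum 'I_m] -> pi z = pi (q (Ordinal m0)).
  by move=> /(_ isT qfib); rewrite leqNgt prednK // leqnn.
by move=> /mapP[i _ ->]; exact: qpi.
Unshelve. all: by end_near. Qed.

End MaxRankEquicontinuous.

Theorem theorem4p7 (R : realType) (G : topologicalZmodType) (X : metricType R)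
    (act : G -> X -> X) (m : nat) :
  hausdorff_space G -> locally_compact [set: G] ->
  compact [set: X] -> continuous_action act -> minimal_action act ->
  (2 <= m)%N ->
  forall (Y : metricType R) (actY : G -> Y -> Y) (pi : X -> Y),
    max_equicontinuous_factor act actY pi ->
    (m_equicontinuous m act <-> max_rank_le pi m.-1).
Proof.
move=> _ _ cX actC amin m2 Y actY pi pi_max; have m0 := ltnW m2.
split; first exact: max_rank_of_m_equicontinuous pi_max m0.
case: (pi_max) => _ fpi eqY _.
exact: m_equicontinuous_of_max_rank fpi eqY m0.
Qed.
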